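(* Let $G_1=(V_1,E_1)$ and $G_2=(V_2,E_2)$ be graphs. Then $\mathrm{thin}(G_1\times G_2)\leq \mathrm{indthin}(G_1\times G_2)\leq \mathrm{indthin}(G_1)|V_2|\leq \mathrm{thin}(G_1)\chi(G_1)|V_2|$ and $\mathrm{pthin}(G_1\times G_2)\leq \mathrm{indpthin}(G_1\times G_2)\leq \mathrm{indpthin}(G_1)|V_2|\leq \mathrm{pthin}(G_1)\chi(G_1)|V_2|$.
   Context: Graphs are finite, simple, undirected; $\chi$ is the chromatic number. The direct (tensor) product $G_1\times G_2$ has vertex set $V_1\times V_2$, and $(u_1,u_2)$, $(v_1,v_2)$ are adjacent iff $u_1v_1\in E_1$ and $u_2v_2\in E_2$. For a graph $G=(V,E)$, an ordering $v_1,\dots,v_n$ of $V$ and a partition of $V$ are consistent if for every $r<s<t$, whenever $v_r,v_s$ are in the same class and $v_tv_r\in E$, then $v_tv_s\in E$; strongly consistent if moreover for every $r<s<t$, whenever $v_s,v_t$ are in the same class and $v_tv_r\in E$, then $v_sv_r\in E$. $\mathrm{thin}(G)$ (resp. $\mathrm{pthin}(G)$) is the minimum number of classes of a partition of $V$ consistent (resp. strongly consistent) with some ordering of $V$; $\mathrm{indthin}$ (resp. $\mathrm{indpthin}$) is the same minimum when each class is additionally required to be an independent set. *)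

(* Defs.v *)
From mathcomp Require Import all_boot.

Set Implicit Arguments.
Unset Strict Implicit.
Unset Printing Implicit Defensive.

Record sgraph := SGraph {
  vertex :> finType;
  adj : rel vertex;
  adj_sym : symmetric adj;
  adj_irrefl : irreflexive adj
}.

Section DirectProduct.
Variables G1 G2 : sgraph.

Definition dprod_adj : rel (G1 * G2)%type :=
  fun u v => adj u.1 v.1 && adj u.2 v.2.

Lemma dprod_adj_sym : symmetric dprod_adj.
Proof. by move=> u v; rewrite /dprod_adj adj_sym [adj u.2 _]adj_sym. Qed.

Lemma dprod_adj_irrefl : irreflexive dprod_adj.
Proof. by move=> u; rewrite /dprod_adj adj_irrefl. Qed.

Definition direct_product : sgraph :=
  @SGraph (G1 * G2)%type dprod_adj dprod_adj_sym dprod_adj_irrefl.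

End DirectProduct.

Section Invariants.
Variable G : sgraph.

Definition proper_coloring k (c : {ffun G -> 'I_k}) : bool :=
  [forall x, forall y, adj x y ==> (c x != c y)].

Definition colorable (k : nat) : bool :=
  [exists c : {ffun G -> 'I_k}, proper_coloring c].

Lemma ex_colorable : exists k, colorable k.
Proof.
exists #|G|; apply/existsP; exists [ffun x => enum_rank x].
apply/forallP => x; apply/forallP => y; apply/implyP => xy.
by rewrite !ffunE (inj_eq enum_rank_inj); apply: contraTneq xy => ->;
  rewrite adj_irrefl.
Qed.

Definition chromatic_number : nat := ex_minn ex_colorable.

Definition independent (A : {set G}) : bool :=
  [forall x in A, forall y in A, ~~ adj x y].

Definition same_class (P : {set {set G}}) (x y : G) : bool :=
  [exists A in P, (x \in A) && (y \in A)].

(* An ordering v_1, ..., v_n of the vertices is an injective map              *)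
(* 'I_#|G| -> G, which is a bijection since both sides have the same          *)
(* cardinality.                                                               *)
Definition is_ordering (v : {ffun 'I_#|G| -> G}) : bool := injectiveb v.

Definition consistent (v : {ffun 'I_#|G| -> G}) (P : {set {set G}}) : bool :=
  [forall r : 'I_#|G|, forall s : 'I_#|G|, forall t : 'I_#|G|,
    (r < s < t) ==>
    (same_class P (v r) (v s) && adj (v t) (v r)) ==> adj (v t) (v s)].

Definition strongly_consistent (v : {ffun 'I_#|G| -> G})
    (P : {set {set G}}) : bool :=
  consistent v P &&
  [forall r : 'I_#|G|, forall s : 'I_#|G|, forall t : 'I_#|G|,
    (r < s < t) ==>
    (same_class P (v s) (v t) && adj (v t) (v r)) ==> adj (v s) (v r)].

Definition independent_classes (P : {set {set G}}) : bool :=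
  [forall A in P, independent A].

Definition has_classes (Q : {ffun 'I_#|G| -> G} -> {set {set G}} -> bool)
    (k : nat) : bool :=
  [exists v : {ffun 'I_#|G| -> G}, exists P : {set {set G}},
    [&& is_ordering v, partition P [set: G], Q v P & #|P| == k]].

Definition thin_with := has_classes consistent.
Definition pthin_with := has_classes strongly_consistent.
Definition indthin_with :=
  has_classes (fun v P => consistent v P && independent_classes P).
Definition indpthin_with :=
  has_classes (fun v P => strongly_consistent v P && independent_classes P).

Lemma has_classesW (Q Q' : {ffun 'I_#|G| -> G} -> {set {set G}} -> bool) :
  (forall v P, Q v P -> Q' v P) ->
  (exists k, has_classes Q k) -> exists k, has_classes Q' k.
Proof.
move=> sQ [k /existsP[v /existsP[P /and4P[ov pP qP cP]]]].
by exists k; apply/existsP; exists v; apply/existsP; exists P; apply/and4P;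
  split=> //; apply: sQ.
Qed.

(* The partition into singletons is strongly consistent with any ordering and *)
(* has independent classes, so the four minima below are over nonempty sets.  *)
Lemma ex_indpthin : exists k, indpthin_with k.
Proof.
pose P := [set [set x] | x in [set: G]].
have sameE x y : same_class P x y -> x = y.
  case/existsP=> A /andP[/imsetP[z _ ->]].
  by rewrite !inE => /andP[/eqP-> /eqP->].
pose v : {ffun 'I_#|G| -> G} := [ffun i => enum_val i].
have vI : injective v by move=> i j; rewrite !ffunE => /enum_val_inj.
exists #|P|; apply/existsP; exists v; apply/existsP; exists P.
apply/and4P; split=> //; first exact/injectiveP.
- apply/and3P; split.
  + rewrite /cover; apply/eqP/setP => x; rewrite inE; apply/bigcupP.
    by exists [set x]; rewrite ?set11 //; apply/imsetP; exists x.
  + apply/trivIsetP => A B /imsetP[x _ ->] /imsetP[y _ ->] neq.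
    rewrite disjoints1 inE; by apply: contraNneq neq => ->.
  + by apply/imsetP => -[x _] /setP/(_ x); rewrite !inE eqxx.
apply/andP; split; first (apply/andP; split).
- apply/forallP => r; apply/forallP => s; apply/forallP => t.
  apply/implyP => /andP[rs st]; apply/implyP => /andP[/sameE/vI E _].
  by rewrite E ltnn in rs.
- apply/forallP => r; apply/forallP => s; apply/forallP => t.
  apply/implyP => /andP[rs st]; apply/implyP => /andP[/sameE/vI E _].
  by rewrite E ltnn in st.
apply/forallP => A; apply/implyP => /imsetP[z _ ->].
apply/forallP => x; apply/implyP; rewrite inE => /eqP->.
by apply/forallP => y; apply/implyP; rewrite inE => /eqP->; rewrite adj_irrefl.
Qed.

Lemma ex_pthin : exists k, pthin_with k.
Proof. by apply: has_classesW ex_indpthin => v P /andP[]. Qed.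

Lemma ex_indthin : exists k, indthin_with k.
Proof. by apply: has_classesW ex_indpthin => v P /andP[/andP[-> _] ->]. Qed.

Lemma ex_thin : exists k, thin_with k.
Proof. by apply: has_classesW ex_indthin => v P /andP[]. Qed.

Definition thin : nat := ex_minn ex_thin.
Definition pthin : nat := ex_minn ex_pthin.
Definition indthin : nat := ex_minn ex_indthin.
Definition indpthin : nat := ex_minn ex_indpthin.

End Invariants.

(* Main.v *)
(* A partition consistent with an ordering is encoded by an injective rank
   f : G -> nat and a labelling c : G -> L of the vertices by their class.
   For the product, rank the pairs lexicographically, first coordinate first,
   and label (x, w) by (class of x, w): two vertices with the same label have
   distinct first coordinates, so every strict comparison descends to G1,
   except that two of the three first coordinates may coincide; then an edge
   would join two vertices of the same class of G1, which independence forbids.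
   For the last inequality of each chain, refine the classes by an optimal
   proper colouring: refinement preserves (strong) consistency. *)
Require Import Defs.
From mathcomp Require Import all_boot.

Set Implicit Arguments.
Unset Strict Implicit.
Unset Printing Implicit Defensive.

(** * Rank-and-label encodings of orderings with partitions *)

Section Labellings.
Variable G : sgraph.

Section Predicates.
Variables (L : eqType) (f : G -> nat) (c : G -> L).

Definition consistent_labelling :=
  forall x y z, f x < f y -> f y < f z -> c x = c y -> adj z x -> adj z y.

Definition backward_consistent_labelling :=
  forall x y z, f x < f y -> f y < f z -> c y = c z -> adj z x -> adj y x.

Definition independent_labelling := forall x y, c x = c y -> ~~ adj x y.

Definition represents (v : {ffun 'I_#|G| -> G}) (P : {set {set G}}) :=
  [/\ forall i j : 'I_#|G|, (f (v i) < f (v j)) = (i < j),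
      forall x, exists i, x = v i
    & forall x y, same_class P x y = (c x == c y)].

Variables (v : {ffun 'I_#|G| -> G}) (P : {set {set G}}).
Hypothesis vP : represents v P.

Lemma consistentP : reflect consistent_labelling (consistent v P).
Proof.
case: vP => vlt vsurj cE; apply: (iffP idP) => [H x y z | H].
  have [[r ->] [s ->] [t ->]] := And3 (vsurj x) (vsurj y) (vsurj z).
  rewrite !vlt => rs st /eqP crs tr.
  move/forallP/(_ r)/forallP/(_ s)/forallP/(_ t): H.
  by rewrite rs st cE crs tr.
apply/forallP => r; apply/forallP => s; apply/forallP => t.
apply/implyP => /andP[rs st]; apply/implyP; rewrite cE => /andP[/eqP crs].
by apply: H; rewrite ?vlt.
Qed.

Lemma strongly_consistentP :
  reflect (consistent_labelling /\ backward_consistent_labelling)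
          (strongly_consistent v P).
Proof.
case: (vP) => vlt vsurj cE.
apply: (iffP andP) => [[/consistentP Hc H] | [/consistentP Hc H]]; split=> //.
  move=> x y z; have [[r ->] [s ->] [t ->]] := And3 (vsurj x) (vsurj y) (vsurj z).
  rewrite !vlt => rs st /eqP cst tr.
  move/forallP/(_ r)/forallP/(_ s)/forallP/(_ t): H.
  by rewrite rs st cE cst tr.
apply/forallP => r; apply/forallP => s; apply/forallP => t.
apply/implyP => /andP[rs st]; apply/implyP; rewrite cE => /andP[/eqP cst].
by apply: H; rewrite ?vlt.
Qed.

Lemma independent_classesP :
  reflect independent_labelling (independent_classes P).
Proof.
case: vP => _ _ cE; apply: (iffP idP) => [H x y /eqP | H].
  rewrite -cE => /existsP[A /and3P[AP xA yA]].
  move/forallP/(_ A)/implyP/(_ AP)/forallP/(_ x)/implyP/(_ xA): H.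
  by move/forallP/(_ y)/implyP/(_ yA).
apply/forallP => A; apply/implyP => AP; apply/forallP => x; apply/implyP => xA.
apply/forallP => y; apply/implyP => yA; apply/H/eqP; rewrite -cE.
by apply/existsP; exists A; rewrite AP xA yA.
Qed.

End Predicates.

(** The rank of a vertex is its position, given by the inverse [g] of [v], and its label is the
    index of its block among the [k] blocks of [P]. *)
Lemma has_classes_labelling Q k : has_classes Q k ->
  exists v P (f : G -> nat) (c : G -> 'I_k),
    [/\ represents f c v P, injective f & Q v P].
Proof.
case/existsP=> v /existsP[P /and4P[/injectiveP vI partP QvP /eqP cardP]].
have [g vK gK] := inj_card_bij vI (eq_leq (esym (card_ord _))).
have /and3P[/eqP covP tiP _] := partP.
have inP x : pblock P x \in P by rewrite pblock_mem ?covP ?inE.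
pose c x := cast_ord cardP (enum_rank_in (inP x) (pblock P x)).
(* The default element inside [enum_rank_in] varies with the vertex; applying [enum_val] removes
   this dependence. *)
have cE x y : (c x == c y) = (pblock P x == pblock P y).
  apply/eqP/eqP => [/cast_ord_inj E|]; last first.
    move=> E; apply/(congr1 (cast_ord _))/enum_val_inj.
    by rewrite !enum_rankK_in.
  have:= congr1 (@enum_val _ (mem P)) E.
  by rewrite !enum_rankK_in.
exists v, P, (fun x => val (g x)), c; split=> //; last first.
  by move=> x y /val_inj /(can_inj gK).
split=> [i j | x | x y]; rewrite ?vK //; first by exists (g x); rewrite gK.
rewrite cE eq_pblock ?covP ?inE //.
apply/existsP/idP => [[A /and3P[AP xA yA]] | yx].
  by rewrite (def_pblock tiP AP xA).
by exists (pblock P x); rewrite inP yx mem_pblock covP inE.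
Qed.

(** Conversely, sorting the vertices by [f] gives the ordering, and the nonempty fibres of [c] give
    the partition. *)
Lemma labelling_represented (L : finType) (f : G -> nat) (c : G -> L) :
  injective f ->
  exists v P, [/\ represents f c v P, is_ordering v,
                  partition P [set: G] & #|P| <= #|L|].
Proof.
move=> fI; pose le x y := f x <= f y; pose s := sort le (enum G).
have size_s : size s == #|G| by rewrite size_sort cardE.
pose v : {ffun 'I_#|G| -> G} := [ffun i => tnth (Tuple size_s) i].
have uniq_s : uniq s by rewrite sort_uniq enum_uniq.
have vI : injective v.
  by move=> i j; rewrite !ffunE; move: i j; apply/tuple_uniqP.
have [g vK gK] := inj_card_bij vI (eq_leq (esym (card_ord _))).
have sorted_s : sorted le s by apply: sort_sorted => x y; apply: leq_total.
have vle (i j : 'I_#|G|) : i <= j -> f (v i) <= f (v j).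
  move=> ij; rewrite !ffunE !(tnth_nth (v i)).
  apply: (sorted_leq_nth _ _ _ sorted_s) => //.
  - by move=> x y z; apply: leq_trans.
  - by move=> x; rewrite /le.
  - by rewrite inE (eqP size_s).
  - by rewrite inE (eqP size_s).
have vlt (i j : 'I_#|G|) : (f (v i) < f (v j)) = (i < j).
  (* Sortedness only gives the weak inequality [vle]; injectivity of [f] and [v] makes it strict. *)
  apply/idP/idP => [|ij]; first by apply: contraTT; rewrite -!leqNgt => /vle.
  rewrite ltn_neqAle vle 1?ltnW // andbT; apply: contraTneq ij.
  by move=> /fI /vI ->; rewrite ltnn.
have partP := preim_partitionP c [set: G].
have /and3P[/eqP covP tiP _] := partP.
exists v, (preim_partition c [set: G]); split=> //; last 2 first.
- exact/injectiveP.
(* Each block is the fibre of [c] over some label, so the blocks lie in an image of [L]. *)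
- apply: (@leq_trans #|[set c @^-1: [set a] | a in [set: L]]|).
    apply/subset_leq_card/subsetP => A /imsetP[x _ ->].
    by apply/imsetP; exists (c x) => //; apply/setP => y; rewrite !inE eq_sym.
  by rewrite -cardsT leq_imset_card.
split=> // [x | x y]; first by exists (g x); rewrite gK.
have eqv : {in [set: G] & &, equivalence_rel [rel x y | c x == c y]}.
  by move=> a b d _ _ _; split=> //= /eqP->.
rewrite -[RHS](pblock_equivalence_partition eqv (in_setT x) (in_setT y)).
apply/existsP/idP => [[A /and3P[AP xA yA]] | yx].
  by rewrite (def_pblock tiP AP xA).
exists (pblock (preim_partition c [set: G]) x).
by rewrite pblock_mem ?covP ?inE // yx mem_pblock covP inE.
Qed.

Lemma has_classes_of_labelling (L : finType) (f : G -> nat) (c : G -> L)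
    (Q : {ffun 'I_#|G| -> G} -> {set {set G}} -> bool) :
  injective f -> (forall v P, represents f c v P -> Q v P) ->
  exists2 k, has_classes Q k & k <= #|L|.
Proof.
move=> fI QvP; have [v [P [vP ov pP cP]]] := labelling_represented c fI.
exists #|P| => //; apply/existsP; exists v; apply/existsP; exists P.
by apply/and4P; split=> //; apply: QvP.
Qed.

(** * Optimal labellings, and upper bounds obtained from labellings *)

Lemma thinP : exists (f : G -> nat) (c : G -> 'I_(thin G)),
  injective f /\ consistent_labelling f c.
Proof.
rewrite /thin; case: ex_minnP => k /has_classes_labelling.
by case=> v [P [f [c [vP fI /(consistentP vP) H]]]] _; exists f, c.
Qed.

Lemma pthinP : exists (f : G -> nat) (c : G -> 'I_(pthin G)),
  [/\ injective f, consistent_labelling f c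
    & backward_consistent_labelling f c].
Proof.
rewrite /pthin; case: ex_minnP => k /has_classes_labelling.
by case=> v [P [f [c [vP fI /(strongly_consistentP vP)[H H']]]]] _; exists f, c.
Qed.

Lemma indthinP : exists (f : G -> nat) (c : G -> 'I_(indthin G)),
  [/\ injective f, consistent_labelling f c & independent_labelling c].
Proof.
rewrite /indthin; case: ex_minnP => k /has_classes_labelling.
case=> v [P [f [c [vP fI /andP[]]]]].
by move=> /(consistentP vP) H /(independent_classesP vP) H' _; exists f, c.
Qed.

Lemma indpthinP : exists (f : G -> nat) (c : G -> 'I_(indpthin G)),
  [/\ injective f, consistent_labelling f c,
      backward_consistent_labelling f c & independent_labelling c].
Proof.
rewrite /indpthin; case: ex_minnP => k /has_classes_labelling.
case=> v [P [f [c [vP fI /andP[]]]]].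
move=> /(strongly_consistentP vP)[H H'] /(independent_classesP vP) Hi _.
by exists f, c.
Qed.

Lemma indthin_le_labelling (L : finType) (f : G -> nat) (c : G -> L) :
  injective f -> consistent_labelling f c -> independent_labelling c ->
  indthin G <= #|L|.
Proof.
move=> fI fc ic; rewrite /indthin; case: ex_minnP => m _ min_m.
have [v P vP|k kP] := @has_classes_of_labelling L f c
  (fun v P => consistent v P && independent_classes P) fI.
  by apply/andP; split; [apply/(consistentP vP) | apply/(independent_classesP vP)].
by apply: leq_trans; apply: min_m.
Qed.

Lemma indpthin_le_labelling (L : finType) (f : G -> nat) (c : G -> L) :
  injective f -> consistent_labelling f c ->
  backward_consistent_labelling f c -> independent_labelling c ->
  indpthin G <= #|L|.
Proof.
move=> fI fc bc ic; rewrite /indpthin; case: ex_minnP => m _ min_m.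
have [v P vP|k kP] := @has_classes_of_labelling L f c
  (fun v P => strongly_consistent v P && independent_classes P) fI.
  apply/andP; split; last exact/(independent_classesP vP).
  exact/(strongly_consistentP vP).
by apply: leq_trans; apply: min_m.
Qed.

Lemma thin_le_indthin : thin G <= indthin G.
Proof.
rewrite /thin /indthin; case: ex_minnP => m _ min_m; case: ex_minnP => k kP _.
apply: min_m; case/existsP: kP => v /existsP[P /and4P[ov pP /andP[cP _] kP]].
by apply/existsP; exists v; apply/existsP; exists P; apply/and4P.
Qed.

Lemma pthin_le_indpthin : pthin G <= indpthin G.
Proof.
rewrite /pthin /indpthin; case: ex_minnP => m _ min_m; case: ex_minnP => k kP _.
apply: min_m; case/existsP: kP => v /existsP[P /and4P[ov pP /andP[cP _] kP]].
by apply/existsP; exists v; apply/existsP; exists P; apply/and4P.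
Qed.

Lemma chromatic_numberP :
  exists col : G -> 'I_(chromatic_number G), independent_labelling col.
Proof.
rewrite /chromatic_number; case: ex_minnP => m /existsP[col colP] _.
exists col => x y /eqP Exy; apply: contraL Exy => xy.
by move/forallP/(_ x)/forallP/(_ y)/implyP/(_ xy): colP.
Qed.

(** Consistency constrains only pairs with equal labels, and pairing [c] with [col] leaves fewer of
    these; the colour component supplies independence. *)
Lemma indthin_le_thin_chromatic : indthin G <= thin G * chromatic_number G.
Proof.
have [f [c [fI fc]]] := thinP; have [col colP] := chromatic_numberP.
have := @indthin_le_labelling _ f (fun x => (c x, col x)) fI.
rewrite card_prod !card_ord; apply=> [x y z xy yz [cxy _]|x y [_ /colP]] //.
exact: fc cxy.
Qed.

Lemma indpthin_le_pthin_chromatic : indpthin G <= pthin G * chromatic_number G.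
Proof.
have [f [c [fI fc bc]]] := pthinP; have [col colP] := chromatic_numberP.
have := @indpthin_le_labelling _ f (fun x => (c x, col x)) fI.
rewrite card_prod !card_ord.
apply=> [x y z xy yz [cxy _]|x y z xy yz [cyz _]|x y [_ /colP]] //.
- exact: fc cxy.
- exact: bc cyz.
Qed.

End Labellings.

(** * Lexicographic ranks and paired labels on the direct product *)

Section Product.
Variables (G1 G2 : sgraph) (L : eqType) (f : G1 -> nat) (c : G1 -> L).
Hypotheses (fI : injective f) (ic : independent_labelling c).

Notation G := (direct_product G1 G2).

(** Since [enum_rank u.2] is below [#|G2|], it acts as a last digit in base [#|G2|], which encodes
    the lexicographic order in [nat]. *)
Definition lex_rank (u : G) : nat := f u.1 * #|G2| + enum_rank u.2.
Definition prod_label (u : G) : L * G2 := (c u.1, u.2).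

Lemma lex_rank_lt_fst u w : f u.1 < f w.1 -> lex_rank u < lex_rank w.
Proof.
move=> uw; rewrite /lex_rank (@leq_trans ((f u.1).+1 * #|G2|)) //.
  by rewrite mulSn addnC ltn_add2r ltn_ord.
by rewrite (leq_trans (leq_mul uw (leqnn _))) ?leq_addr.
Qed.

Lemma lex_rank_le_fst u w : lex_rank u < lex_rank w -> f u.1 <= f w.1.
Proof.
apply: contraTT; rewrite -ltnNge -leqNgt => /lex_rank_lt_fst.
exact: ltnW.
Qed.

(** With equal last digits, a tie in the first coordinates would make the two ranks equal. *)
Lemma lex_rank_lt_same_snd u w :
  u.2 = w.2 -> lex_rank u < lex_rank w -> f u.1 < f w.1.
Proof.
move=> E uw; rewrite ltn_neqAle lex_rank_le_fst // andbT.
by apply: contraTneq uw; rewrite /lex_rank E => ->; rewrite ltnn.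
Qed.

Lemma lex_rank_inj : injective lex_rank.
Proof.
move=> u w E.
have E1 : f u.1 = f w.1.
  by case: (ltngtP (f u.1) (f w.1)) => // /lex_rank_lt_fst; rewrite E ltnn.
move/eqP: E; rewrite /lex_rank E1 eqn_add2l => /eqP/val_inj/enum_rank_inj E2.
by move/fI: E1 E2; case: u w => [u1 u2] [w1 w2] /= -> ->.
Qed.

(** Equal labels force equal second coordinates, and an edge would then project to a loop in
    [G2]. *)
Lemma prod_label_independent : independent_labelling prod_label.
Proof. by move=> u w [_ E]; rewrite /= /dprod_adj E adj_irrefl andbF. Qed.

Lemma prod_label_consistent :
  consistent_labelling f c -> consistent_labelling lex_rank prod_label.
Proof.
move=> fc x y z xy yz [cE E2] /andP[zx1 zx2]; apply/andP; rewrite -E2; split=> //.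
have xy1 := lex_rank_lt_same_snd E2 xy.
(* If [y] and [z] share their first coordinate, [zx1] becomes an edge between [y.1] and [x.1], which
   have the same label under [c]. *)
have:= lex_rank_le_fst yz; rewrite leq_eqVlt => /predU1P[/fI E | yz1].
  by move: (ic cE); rewrite adj_sym E zx1.
exact: fc cE zx1.
Qed.

Lemma prod_label_backward_consistent :
  backward_consistent_labelling f c ->
  backward_consistent_labelling lex_rank prod_label.
Proof.
move=> bc x y z xy yz [cE E2] /andP[zx1 zx2]; apply/andP; rewrite E2; split=> //.
have yz1 := lex_rank_lt_same_snd E2 yz.
(* Here the possible tie is between [x] and [y], and [zx1] would join [z.1] to [y.1] inside one
   class. *)
have:= lex_rank_le_fst xy; rewrite leq_eqVlt => /predU1P[/fI E | xy1].
  by move: (ic cE); rewrite -E adj_sym zx1.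
exact: bc cE zx1.
Qed.

End Product.

(** * Bounds for the direct product and assembly of both chains *)

Lemma indthin_direct_product (G1 G2 : sgraph) :
  indthin (direct_product G1 G2) <= indthin G1 * #|G2|.
Proof.
have [f [c [fI fc ic]]] := indthinP G1.
have := indthin_le_labelling (lex_rank_inj fI)
  (prod_label_consistent (G2 := G2) fI ic fc) (@prod_label_independent _ _ _ _).
by rewrite card_prod card_ord.
Qed.

Lemma indpthin_direct_product (G1 G2 : sgraph) :
  indpthin (direct_product G1 G2) <= indpthin G1 * #|G2|.
Proof.
have [f [c [fI fc bc ic]]] := indpthinP G1.
have := indpthin_le_labelling (lex_rank_inj fI)
  (prod_label_consistent (G2 := G2) fI ic fc)
  (prod_label_backward_consistent fI ic bc) (@prod_label_independent _ _ _ _).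
by rewrite card_prod card_ord.
Qed.

Theorem theorem4p31 (G1 G2 : sgraph) :
  [/\ thin (direct_product G1 G2) <= indthin (direct_product G1 G2),
      indthin (direct_product G1 G2) <= indthin G1 * #|G2|
    & indthin G1 * #|G2| <= thin G1 * chromatic_number G1 * #|G2|]
  /\
  [/\ pthin (direct_product G1 G2) <= indpthin (direct_product G1 G2),
      indpthin (direct_product G1 G2) <= indpthin G1 * #|G2|
    & indpthin G1 * #|G2| <= pthin G1 * chromatic_number G1 * #|G2|].
Proof.
split; split.
- exact: thin_le_indthin.
- exact: indthin_direct_product.
- by rewrite leq_mul ?indthin_le_thin_chromatic.
- exact: pthin_le_indpthin.
- exact: indpthin_direct_product.
- by rewrite leq_mul ?indpthin_le_pthin_chromatic.
Qed.
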